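(* Let $G=(V,E)$ be an infinite, connected, simple graph with bounded maximal degree, and let the initial water levels $\{\eta_0(u)\}_{u\in V}$ be i.i.d. random variables with the uniform distribution on $[0,1]$. Let $v\in V$ be a fixed vertex. If $G$ contains a neighbor-rich half-line, then $\kappa(v)=1$ almost surely.
   Context: Water transport: given a graph $G=(V,E)$ and an initial water profile $\{\eta_0(u)\}_{u\in V}$, in round $k\ge 1$ one chooses an edge $\langle x,y\rangle\in E$ and $\mu_k\in[0,\tfrac12]$ and sets $$\eta_k(x)=\eta_{k-1}(x)+\mu_k\,(\eta_{k-1}(y)-\eta_{k-1}(x)),\qquad \eta_k(y)=\eta_{k-1}(y)+\mu_k\,(\eta_{k-1}(x)-\eta_{k-1}(y)),$$ with $\eta_k(w)=\eta_{k-1}(w)$ for all $w\in V\setminus\{x,y\}$. A finite move sequence is a finite list $\big((e_k,\mu_k)\big)_{k=1}^T\in(E\times[0,\tfrac12])^T$, $T\in\{0,1,2,\dots\}$. For $v\in V$, $\kappa(v)$ is the supremum of all values $\eta_T(v)$ achievable from the given initial profile by finite move sequences (over all $T$). For random initial levels the move sequence may depend on the realized initial profile, so $\kappa(v)$ is a random variable. Neighbor-rich half-line: with $\mathbb{N}=\{1,2,\dots\}$, an infinite connected simple graph $G=(V,E)$ is said to contain a neighbor-rich half-line if it has a subgraph that is a half-line $H=\big(\{v_k,\,k\in\mathbb{N}\},\{\langle v_k,v_{k+1}\rangle,\,k\in\mathbb{N}\}\big)$ (with distinct vertices $v_k$) and there are distinct vertices $\{u_k,\,k\in\mathbb{N}\}$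 in $V\setminus\{v_k,\,k\in\mathbb{N}\}$ and an injective function $f:\mathbb{N}\to\mathbb{N}$ such that (i) $\langle u_k,v_{f(k)}\rangle\in E$ for all $k\in\mathbb{N}$, and (ii) $\sum_{k=1}^\infty\frac1{f(k)}=\infty$. *)

(* Defs.v *)
From mathcomp Require Import all_boot all_order all_algebra.
From mathcomp Require Import all_classical all_reals all_analysis.

Set Implicit Arguments.
Unset Strict Implicit.
Unset Printing Implicit Defensive.

Import Order.TTheory GRing.Theory Num.Theory.
Local Open Scope classical_set_scope.
Local Open Scope ring_scope.

Definition simple_graph (V : choiceType) (e : rel V) : Prop :=
  symmetric e /\ irreflexive e.

Definition connected_graph (V : choiceType) (e : rel V) : Prop :=
  forall x y : V, exists2 p : seq V, path e x p & last x p = y.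

Definition bounded_degree (V : choiceType) (e : rel V) : Prop :=
  exists D : nat, forall x : V, ([set y | e x y] #<= `I_D)%card.

(* The vertices v_1, v_2, ... and u_1, u_2, ... and the values of f are shifted
   by one so as to be indexed by [nat]; hence the weight 1 / (f k + 1). *)
Definition neighbor_rich_half_line (R : realType) (V : choiceType) (e : rel V)
    : Prop :=
  exists (h u : nat -> V) (f : nat -> nat),
    (injective h /\ forall k, e (h k) (h k.+1)) /\
    (injective u /\ forall j k, u k != h j) /\
    injective f /\
    (forall k, e (u k) (h (f k))) /\
    (\sum_(0 <= k <oo) ((f k).+1%:R^-1 : R)%:E = +oo)%E.

(* A move (x, y, mu) levels the profile along the edge <x, y>. *)
Definition move (R : realType) (V : choiceType) : Type := (V * V * R)%type.

Definition admissible (R : realType) (V : choiceType) (e : rel V)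
    (m : move R V) : bool :=
  let: (x, y, mu) := m in e x y && (0 <= mu <= 2^-1).

Definition pour (R : realType) (V : choiceType) (eta : V -> R) (m : move R V)
    : V -> R :=
  let: (x, y, mu) := m in
  fun w => if w == x then eta x + mu * (eta y - eta x)
           else if w == y then eta y + mu * (eta x - eta y)
           else eta w.

(* The supremum is taken in the extended reals, so that it is the actual
   supremum for every profile, bounded or not. *)
Definition kappa (R : realType) (V : choiceType) (e : rel V) (eta0 : V -> R)
    (v : V) : \bar R :=
  ereal_sup [set (foldl (@pour R V) eta0 ms v)%:E
            | ms in [set ms : seq (move R V) | all (admissible e) ms]].

Definition mutually_independent (d : measure_display) (Omega : measurableType d)
    (R : realType) (P : probability Omega R) (I : choiceType)
    (X : I -> {RV P >-> R}) : Prop :=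
  forall (s : seq I) (B : I -> set R), uniq s ->
    (forall i, measurable (B i)) ->
    P (\bigcap_(i in [set` s]) (X i @^-1` B i)) =
    (\prod_(i <- s) P (X i @^-1` B i))%E.

Definition uniform01 (d : measure_display) (Omega : measurableType d)
    (R : realType) (P : probability Omega R) (X : {RV P >-> R}) : Prop :=
  forall A : set R, measurable A ->
    distribution P X A = uniform_prob (@ltr01 R) A.

(* Main.v *)
(** Join [v] to the start [h 0] of the half-line by a walk [p].  Call [u k] good if
    it lies off [p] and its level is at least [b < 1].  Treat the good [u k] in order
    of decreasing [f k]: average [u k] with [h (f k)], then level the walk from [v]
    to [h (f k)].  If that walk, of [N = size p + f k + 1] vertices, was at level at
    least [a], it ends up at level at least [a + (b - a) / (4 N)], so the deficit
    [b - a] shrinks by the factor [1 - c k], where [c k = 1 / (4 N)] ([c k = 0] if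
    [u k] lies on [p]).  Hence [v] attains
    [b * (1 - \prod_(k good, k < n) (1 - c k))].  By independence the expectation of
    this product is [\prod_(k < n) (1 - c k * (1 - b))], which tends to [0] because
    [\sum_k c k] diverges; as the product decreases in [n], it tends to [0] almost
    surely. *)

Require Import Defs.
From mathcomp Require Import all_boot all_order all_algebra.
From mathcomp Require Import all_classical all_reals all_analysis.
From mathcomp Require Import measurable_realfun lra ring.
Set Implicit Arguments.
Unset Strict Implicit.
Unset Printing Implicit Defensive.
Import Order.TTheory GRing.Theory Num.Theory.
Import numFieldTopology.Exports.
Local Open Scope classical_set_scope.
Local Open Scope ring_scope.

(** * Transport along a half-line *)

Section Transport.
Context (R : realType) (V : choiceType) (e : rel V).
Implicit Types (eta : V -> R) (ms : seq (move R V)).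
Local Notation pours := (foldl (@pour R V)).

(** Serves twice: with [F] the square it measures the loss of the quadratic potential, with [F] the
    identity it gives conservation of water. *)
Lemma sum_pour (F : R -> R) eta (x y : V) (mu : R) (s : seq V) :
  uniq s -> x \in s -> y \in s -> x != y ->
  \sum_(z <- s) F (pour eta (x, y, mu) z) =
  \sum_(z <- s) F (eta z) + (F (eta x + mu * (eta y - eta x)) - F (eta x))
                          + (F (eta y + mu * (eta x - eta y)) - F (eta y)).
Proof.
move=> us xs ys xy.
have split_sum (G : V -> R) : \sum_(z <- s) G z =
    G x + (G y + \sum_(z <- s | (z != x) && (z != y)) G z).
  rewrite (bigD1_seq x)//=; congr (_ + _); rewrite (big_rem y)//= eq_sym xy.
  congr (_ + _); rewrite rem_filter// big_filter_cond.
  by apply: eq_bigl => z; rewrite andbC.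
rewrite [LHS]split_sum [in RHS]split_sum /= !eqxx eq_sym (negPf xy).
under eq_bigr => z /andP[/negPf -> /negPf ->] do [].
ring.
Qed.

Lemma pour_out eta (x y z : V) (mu : R) :
  z != x -> z != y -> pour eta (x, y, mu) z = eta z.
Proof. by rewrite /pour => /negPf -> /negPf ->. Qed.

(* Levelling an edge with difference at least theta lowers the sum of squares
   by at least theta^2 / 2, so this can happen only finitely often. *)
Lemma levelling (s : seq V) (theta : R) eta :
  irreflexive e -> uniq s -> 0 < theta ->
  exists ms, [/\ all (admissible e) ms,
    forall z, z \notin s -> pours eta ms z = eta z,
    \sum_(z <- s) pours eta ms z = \sum_(z <- s) eta z &
    forall x y, x \in s -> y \in s -> e x y ->
      `|pours eta ms x - pours eta ms y| <= theta].
Proof.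
move=> irr us theta0.
have c0 : 0 < theta ^+ 2 / 2 by rewrite divr_gt0// exprn_gt0.
pose Q eta := \sum_(z <- s) eta z ^+ 2.
(* [N] bounds the number of levelling moves still needed: each costs at least [theta^2 / 2] of the
   nonnegative potential [Q]. *)
have [N] : exists N : nat, Q eta <= N%:R * (theta ^+ 2 / 2).
  exists (Num.bound (Q eta / (theta ^+ 2 / 2))).
  rewrite -ler_pdivrMr//; apply/ltW/archi_boundP.
  by rewrite divr_ge0 ?sumr_ge0// ?ltW// => z _; exact: sqr_ge0.
elim: N eta => [|N IH] eta QN.
all: have [flat|] := pselect (forall x y, x \in s -> y \in s -> e x y ->
      `|eta x - eta y| <= theta); first by exists [::]; split.
all: move=> /existsNP[x] /existsNP[y] /not_implyP[xs] /not_implyP[ys].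
all: move=> /not_implyP[exy] /negP; rewrite -ltNge => gap.
all: have xy : x != y by apply: contraTneq exy => ->; rewrite irr.
all: have sq : theta ^+ 2 < (eta x - eta y) ^+ 2
       by rewrite -[ltRHS]real_normK ?num_real// ltr_pXn2r// nnegrE// ltW.
all: have := sum_pour (fun r => r ^+ 2) eta 2^-1 us xs ys xy.
all: rewrite -![\sum_(_ <- _) _]/(Q _) => Qpour.
(* With no budget left, one more levelling would make [Q] negative. *)
- have : 0 <= Q (pour eta (x, y, 2^-1)) by apply: sumr_ge0 => z _; exact: sqr_ge0.
  by rewrite Qpour; move: QN; rewrite mul0r; nra.
have /IH[ms [adm out tot flat]] :
    Q (pour eta (x, y, 2^-1)) <= N%:R * (theta ^+ 2 / 2).
  by rewrite Qpour; move: QN; rewrite -natr1; nra.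
exists ((x, y, 2^-1) :: ms); split => //=.
- by rewrite exy adm invr_ge0 ler0n lexx.
- move=> z zs; rewrite out// pour_out//; first by apply: contraNneq zs => ->.
  by apply: contraNneq zs => ->.
- by rewrite tot (sum_pour id)//; ring.
Qed.

Lemma path_oscillation (g : V -> R) (theta : R) (x : V) (p : seq V) :
  path e x p -> 0 <= theta ->
  (forall y z, y \in x :: p -> z \in x :: p -> e y z -> `|g y - g z| <= theta) ->
  forall z, z \in x :: p -> `|g z - g x| <= (size p)%:R * theta.
Proof.
move=> + theta0; elim: p x => [|y p IH] x /=.
  by move=> _ _ z; rewrite inE => /eqP ->; rewrite subrr normr0 mul0r.
move=> /andP[exy yp] small z; rewrite inE => /predU1P[->|zp].
  by rewrite subrr normr0 mulr_ge0.
rewrite -(subrKA (g y)) (le_trans (ler_normD _ _))// -natr1 mulrDl mul1r lerD//.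
  by apply: IH => // a b ap bp; apply: small; rewrite inE ?ap ?bp orbT.
by rewrite distrC small// !inE eqxx ?orbT.
Qed.

(** Levelling keeps the total, which exceeds [a] times the number of vertices by at least [delta].
    On an almost flat walk each vertex shares in this surplus; half of the share [delta / N] is
    given up to the remaining unevenness. *)
Lemma raise_walk (x0 : V) (p : seq V) eta (a delta : R) (y : V) :
  irreflexive e -> path e x0 p -> 0 <= delta ->
  (forall x, x \in x0 :: p -> a <= eta x) ->
  y \in x0 :: p -> a + delta <= eta y ->
  exists ms, [/\ all (admissible e) ms,
    forall z, z \notin x0 :: p -> pours eta ms z = eta z &
    forall x, x \in x0 :: p ->
      a + delta / (2 * (size p).+1%:R) <= pours eta ms x].
Proof.
move=> irr walk; rewrite le_eqVlt => /predU1P[<-|delta0] low yp high.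
  by exists [::]; split => // x /low; rewrite mul0r addr0.
(* The walk may revisit vertices: [N] counts them with repetition, while sums run over the distinct
   ones in [s]. *)
set N : R := (size p).+1%:R; set s := undup (x0 :: p).
have N0 : 0 < N by rewrite ltr0n.
(* With this tolerance per edge, levels differ from that of [x0] by at most [delta / (4 * N)], hence
   from each other by at most [delta / (2 * N)]. *)
have theta0 : 0 < delta / (4 * N ^+ 2).
  by rewrite divr_gt0// mulr_gt0// exprn_gt0.
have [ms [adm out tot flat]] :=
  levelling eta irr (undup_uniq (x0 :: p)) theta0.
exists ms; split => // [z zp|x xp]; first by rewrite out// mem_undup.
have osc z : z \in x0 :: p ->
    `|pours eta ms z - pours eta ms x0| <= N * (delta / (4 * N ^+ 2)).
  move=> zp; apply: le_trans (path_oscillation walk (ltW theta0) _ zp) _.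
    by move=> u w up wp; apply: flat; rewrite mem_undup.
  by rewrite ler_wpM2r ?(ltW theta0)// ler_nat.
have NE : N * (delta / (4 * N ^+ 2)) = delta / (4 * N) by field; rewrite gt_eqF.
set b := pours eta ms x + delta / (2 * N).
have const_sum (c : R) : (size s)%:R * c = \sum_(z <- s) c.
  by rewrite big_const_seq count_predT iter_addr_0 mulr_natl.
have upper : \sum_(z <- s) pours eta ms z <= (size s)%:R * b.
  rewrite const_sum; rewrite big_seq [leRHS]big_seq; apply: ler_sum => z; rewrite mem_undup => zp; have := osc _ zp; have := osc _ xp; rewrite NE.
  have -> : b = pours eta ms x + 2 * (delta / (4 * N)).
    by rewrite /b; field; rewrite gt_eqF.
  move: (delta / (4 * N)) => D; rewrite !ler_norml.
  move=> /andP[? ?] /andP[? ?]; lra.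
have lower : (size s)%:R * a + delta <= \sum_(z <- s) eta z.
  rewrite const_sum.
  rewrite (bigD1_seq y)/= ?undup_uniq ?mem_undup//.
  rewrite [leRHS](bigD1_seq y)/= ?undup_uniq ?mem_undup//.
  rewrite addrAC lerD//; rewrite big_seq_cond [leRHS]big_seq_cond; apply: ler_sum => z /andP[+ _].
  by rewrite mem_undup => /low.
have ba : a + delta / N <= b.
  have sN : (size s)%:R <= N by rewrite ler_nat size_undup.
  have s0 : 0 <= (size s)%:R :> R by [].
  have gain : delta <= (size s)%:R * (b - a).
    by rewrite mulrBr lerBrDl (le_trans lower)// -tot.
  (* The sign is needed to replace [size s] by the larger [N] in [gain]. *)
  have ba : 0 < b - a.
    rewrite ltNge; apply/negP => /(mulr_ge0_le0 s0) ?.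
    by move: delta0; rewrite ltNge (le_trans gain).
  rewrite -lerBrDl ler_pdivrMr// (le_trans gain)// mulrC ler_wpM2l//.
  exact: ltW.
have NE2 : delta / N = delta / (2 * N) + delta / (2 * N).
  by field; rewrite gt_eqF.
by rewrite -(lerD2r (delta / (2 * N))) -addrA -NE2.
Qed.

(** * Collecting water from the neighbors of the half-line *)

Section Collect.
Variables (v : V) (p : seq V) (h u : nat -> V) (f : nat -> nat).
Hypotheses (irr : irreflexive e) (walk : path e v p) (walk_end : last v p = h 0).
Hypothesis half_line : forall k, e (h k) (h k.+1).
Hypotheses (u_inj : injective u) (u_h : forall j k, u k != h j).
Hypothesis u_adj : forall k, e (u k) (h (f k)).

(** [v :: tail j] is the walk from [v] to [h j]; [h 0] is omitted because it already ends
    [v :: p]. *)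
Let tail j := p ++ [seq h i | i <- iota 1 j].

Let tail_path j : path e v (tail j).
Proof.
rewrite cat_path walk walk_end /=.
by elim: j 0%N => //= j IH i; rewrite half_line IH.
Qed.

Let tailP j x : reflect (x \in v :: p \/ exists2 i, i <= j & x = h i)%N
  (x \in v :: tail j).
Proof.
rewrite -cat_cons mem_cat; apply: (iffP orP) => -[|].
- by left.
- by move=> /mapP[i]; rewrite mem_iota => /andP[_ ij] ->; right; exists i.
- by left.
- move=> [[|i] ij ->]; first by left; rewrite -walk_end mem_last.
  by right; apply: map_f; rewrite mem_iota.
Qed.

(* Averaging [u k] with [h (f k)] raises the walk's total by half the deficit;
   levelling only approximately costs another factor 2. *)
Definition share k : R := (4 * (size p + f k).+1%:R)^-1.

Lemma share_ge0 k : 0 <= share k.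
Proof. by rewrite invr_ge0 mulr_ge0. Qed.

Lemma share_le1 k : share k <= 1.
Proof.
rewrite invf_le1 ?mulr_gt0//; have : 1 <= (size p + f k).+1%:R :> R by rewrite ler1n.
by lra.
Qed.

(* The list is ascending in [f] and consumed from its tail, so the farthest [u k]
   is treated first; [u i] with [i \notin ks] must stay untouched until its turn. *)
Lemma collect eta (b : R) (ks : seq nat) j :
  (forall x, 0 <= eta x) -> 0 <= b -> uniq ks -> sorted (relpre f leq) ks ->
  (forall k, k \in ks -> u k \notin v :: p /\ b <= eta (u k)) ->
  (forall k, k \in ks -> j <= f k)%N ->
  exists ms, [/\ all (admissible e) ms,
    forall i, u i \notin v :: p -> i \notin ks -> pours eta ms (u i) = eta (u i) &
    forall x, x \in v :: tail j ->
      b * (1 - \prod_(k <- ks) (1 - share k)) <= pours eta ms x].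
Proof.
move=> eta0 b0; elim: ks j => [|k ks IH] j /=.
  by exists [::]; split => // x _; rewrite big_nil subrr mulr0.
move=> /andP[kks uks] sks good jks.
have [||i iks|i iks|ms [adm out low]] := IH (f k).
- by [].
- exact: path_sorted sks.
- by apply: good; rewrite inE iks orbT.
- by move: sks => /(order_path_min (fun _ _ _ => @leq_trans _ _ _))/allP/(_ i iks).
have [ukp bu] := good k (mem_head _ _).
set a := b * (1 - _) in low.
have u_out i l : u i \notin v :: p -> u i \notin v :: tail l.
  move=> up; apply/tailP => -[|[n _ un]]; first exact/negP.
  by have := u_h n i; rewrite un eqxx.
have hk : h (f k) \in v :: tail (f k) by apply/tailP; right; exists (f k).
have ab : 0 <= (b - a) / 2.
  rewrite divr_ge0// /a mulrBr mulr1 subKr mulr_ge0// prodr_ge0// => i _.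
  by rewrite subr_ge0 share_le1.
(* [u k] still has its initial level, at least [b], and [h (f k)] has at least [a], so their average
   is at least [a + (b - a) / 2]. *)
pose eta1 := pour (pours eta ms) (u k, h (f k), 2^-1).
have [||ms' [adm' out' low']] := @raise_walk v (tail (f k)) eta1 a ((b - a) / 2)
    (h (f k)) irr (tail_path _) ab _ hk.
- move=> x xS; have [->|xh] := eqVneq x (h (f k)).
    rewrite /eta1 /= eq_sym (negPf (u_h _ _)) eqxx out//.
    by have := low _ hk; move: ab bu; lra.
  by rewrite /eta1 pour_out// ?low//; apply: contraTneq xS => ->; exact: u_out.
- rewrite /eta1 /= eq_sym (negPf (u_h _ _)) eqxx out//.
  by have := low _ hk; move: ab bu; lra.
exists (ms ++ (u k, h (f k), 2^-1) :: ms'); split.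
- by rewrite all_cat adm /= u_adj adm' invr_ge0 ler0n lexx.
- move=> i ip; rewrite inE negb_or => /andP[ik iks].
  rewrite foldl_cat /= -/eta1 out'; last exact: u_out.
  by rewrite /eta1 pour_out ?out ?u_h// (inj_eq u_inj).
- move=> x xS; rewrite foldl_cat /= -/eta1; apply: le_trans (low' _ _).
    rewrite big_cons /a; set q := \prod_(_ <- _) _.
    rewrite size_cat size_map size_iota /share.
    set N : R := (size p + f k).+1%:R; have N0 : N != 0 by rewrite pnatr_eq0.
    suff -> : b * (1 - (1 - (4 * N)^-1) * q) =
      b * (1 - q) + (b - b * (1 - q)) / 2 / (2 * N) by [].
    by field.
  (* As [j <= f k], the walk to [h j] lies inside the one just raised. *)
  move: xS => /tailP[?|[i ij ->]]; apply/tailP; [by left|right].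
  by exists i => //; apply: leq_trans ij (jks _ (mem_head _ _)).
Qed.

Lemma collected_level eta (b : R) (n : nat) :
  (forall x, 0 <= eta x) -> 0 <= b ->
  ((b * (1 - \prod_(k < n)
     (1 - (if (u k \notin v :: p) && (b <= eta (u k)) then share k else 0))))%:E
   <= kappa e eta v)%E.
Proof.
move=> eta0 b0.
pose good k := (u k \notin v :: p) && (b <= eta (u k)).
pose ks := sort (relpre f leq) [seq k <- iota 0 n | good k].
have goodks k : k \in ks -> good k.
  by rewrite mem_sort mem_filter => /andP[].
have [|||//|ms [adm _ low]] := @collect eta b ks 0 eta0 b0.
- by rewrite sort_uniq filter_uniq// iota_uniq.
- by apply: sort_sorted => i j; exact: leq_total.
- by move=> k /goodks/andP[].
apply: le_trans (ereal_sup_ubound _); last by exists ms.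
have -> : \prod_(k < n) (1 - (if good k then share k else 0)) =
    \prod_(k <- ks) (1 - share k).
  rewrite (perm_big _ (permEl (perm_sort _ _))) big_filter.
  rewrite -(big_mkord xpredT (fun k => 1 - (if good k then share k else 0))).
  rewrite /index_iota subn0 [RHS]big_mkcond; apply: eq_bigr => k _.
  by case: ifP; rewrite ?subr0.
by rewrite lee_fin low// mem_head.
Qed.

End Collect.
End Transport.
(** * Random products *)

Section DampedProducts.
Context (d : measure_display) (Omega : measurableType d) (R : realType).
Context (P : probability Omega R).
Variables (G : nat -> set Omega) (c : nat -> R) (q : R).
Hypothesis mG : forall k, measurable (G k).
Hypothesis indepG : forall s : seq nat, uniq s ->
  P (\bigcap_(k in [set` s]) G k) = (q ^+ size s)%:E.
Hypothesis c01 : forall k, 0 <= c k <= 1.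

Definition damped_prod n (w : Omega) : R := \prod_(k < n) (1 - c k * \1_(G k) w).
Local Notation Y := damped_prod.

Lemma damped_prod01 n w : 0 <= Y n w <= 1.
Proof.
have factor01 k : 0 <= 1 - c k * \1_(G k) w <= 1.
  have /andP[? ?] := c01 k.
  by rewrite indicE; case: (_ \in _); rewrite ?mulr1 ?mulr0; lra.
rewrite prodr_ge0 => [|k _]; last by case/andP: (factor01 k).
by rewrite prodr_ile1// => k _; exact: factor01.
Qed.

Lemma measurable_damped_prod n : measurable_fun setT (Y n).
Proof.
apply: measurable_prod => k _; apply: measurable_funB => //.
by apply: measurable_funM => //; exact: measurable_indic.
Qed.

Lemma integrable_bounded01 (D : set Omega) (f : Omega -> R) :
  measurable D -> measurable_fun setT f -> (forall w, 0 <= f w <= 1) ->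
  P.-integrable D (EFin \o f).
Proof.
move=> mD mf f01; apply: measurable_bounded_integrable => //.
- by rewrite (le_lt_trans (probability_le1 P mD)) ?ltry.
- exact: measurable_funTS.
- exists 1; split => // M M1 w _ /=; have /andP[f0 f1] := f01 w.
  by rewrite ger0_norm// (le_trans f1)// ltW.
Qed.

(* The extra events [G k], [k \in s], make the induction go through: the indicator
   in the last factor moves into the domain of integration. *)
Lemma integral_damped_prod n (s : seq nat) :
  uniq s -> all (leq n) s ->
  (\int[P]_(w in \bigcap_(k in [set` s]) G k) Y n w)%R =
  q ^+ size s * \prod_(k < n) (1 - c k * q).
Proof.
elim: n s => [|n IH] s us ns.
  under eq_Rintegral do rewrite /Y big_ord0.
  rewrite Rintegral_cst ?big_ord0 ?mulr1 ?mul1r//; first by rewrite -[RHS]/(fine _%:E) -(indepG us).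
  by apply: bigcap_measurableType.
set D := \bigcap_(k in _) _.
have mD : measurable D by apply: bigcap_measurableType.
have DG : D `&` G n = \bigcap_(k in [set` n :: s]) G k.
  apply/seteqP; split => w /= => [[Dw Gw] k|Dw].
    by rewrite /= inE => /predU1P[->//|]; exact: Dw.
  by split => [k ks|]; apply: Dw; rewrite /= inE ?eqxx// ks orbT.
(* The restriction of [Y n] to [G n] takes the default value [point] outside, which is [0] in
   [R]. *)
have YS w : Y n.+1 w = Y n w - c n * (Y n \_ (G n)) w.
  rewrite {1}/damped_prod big_ord_recr/= -/(Y n w) patchE indicE.
  case: ifP => _ /=; rewrite -?[point]/(0 : R); ring.
under eq_Rintegral do rewrite YS.
have mYG : measurable_fun setT (Y n \_ (G n)).
  by apply/(measurable_restrictT _ _).1 => //; apply: measurable_funTS;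
     exact: measurable_damped_prod.
have YG01 w : 0 <= (Y n \_ (G n)) w <= 1.
  by rewrite patchE; case: ifP; rewrite ?lexx ?ler01 ?damped_prod01.
have iY := integrable_bounded01 mD (measurable_damped_prod n) (damped_prod01 n).
have iYG := integrable_bounded01 mD mYG YG01.
rewrite RintegralB//; last first.
  by apply: eq_integrable (integrableZl mD (c n) iYG).
have ns' : all (leq n) s by apply: sub_all ns => k /ltnW.
have uns : uniq (n :: s).
  by rewrite /= us andbT; apply/negP => /(allP ns); rewrite ltnn.
have nns : all (leq n) (n :: s) by rewrite /= leqnn.
(* The induction hypothesis is used for both [s] and [n :: s]; the latter contributes the extra
   factor [q]. *)
by rewrite RintegralZl// -Rintegral_mkcondr DG !IH// big_ord_recr/= exprS; ring.
Qed.

(** An elementary substitute for the exponential bound: inductively,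
    [(1 - x) * (1 + S + x) <= 1 + S] for [x] and [S] nonnegative. *)
Lemma prod_le_inv_sum (x : nat -> R) n : (forall k, 0 <= x k <= 1) ->
  \prod_(k < n) (1 - x k) * (1 + \sum_(k < n) x k) <= 1.
Proof.
move=> x01; elim: n => [|n IH]; first by rewrite !big_ord0 addr0 mulr1.
rewrite !big_ord_recr/= (le_trans _ IH)// -mulrA ler_wpM2l//.
  by apply: prodr_ge0 => k _; rewrite subr_ge0; case/andP: (x01 k).
have S0 : 0 <= \sum_(k < n) x k by apply: sumr_ge0 => k _; case/andP: (x01 k).
by have /andP[] := x01 n; nra.
Qed.

(** Markov's inequality bounds [delta] times this probability by the expectation of every [Y n], and
    these expectations tend to [0]. *)
Lemma damped_prod_null (delta : R) : 0 < q <= 1 -> 0 < delta ->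
  (forall M, exists n, M <= \sum_(k < n) c k) ->
  P (\bigcap_n [set w | delta <= Y n w]) = 0%E.
Proof.
move=> /andP[q0 q1] delta0 diverge.
set B := \bigcap_n _.
have mB : measurable B.
  apply: bigcapT_measurable => n.
  rewrite -[X in measurable X]setTI -[X in _ `&` X]/(Y n @^-1` [set r | delta <= r]).
  by rewrite -set_itvcy; apply: measurable_damped_prod.
have fB : P B \is a fin_num by exact: fin_num_measure.
have i1B : P.-integrable setT (EFin \o \1_B).
  apply: integrable_bounded01 => // w.
  by rewrite indicE; case: (_ \in _); rewrite ?lexx ?ler01.
have bound n : delta * fine (P B) <= \prod_(k < n) (1 - c k * q).
  have := @integral_damped_prod n [::] isT isT.
  rewrite expr0 mul1r => <-; rewrite (_ : \bigcap_(k in _) _ = setT); last first.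
    by apply/seteqP; split.
  have -> : delta * fine (P B) = \int[P]_w (delta * \1_B w).
    rewrite RintegralZl//.
    by rewrite /Rintegral integral_indic// setIT.
  apply: le_Rintegral => //.
  - exact: eq_integrable (integrableZl measurableT delta i1B).
  - exact: integrable_bounded01 (measurable_damped_prod n) (damped_prod01 n).
  - move=> w _; rewrite indicE; case: (boolP (w \in B)) => [/set_mem Bw|_] /=.
      by rewrite mulr1; exact: (Bw n I).
    by rewrite mulr0; case/andP: (damped_prod01 n w).
apply/eqP; rewrite -(fineK fB) eqe eq_le fine_ge0// andbT leNgt.
apply/negP => PB0.
have db : 0 < delta * fine (P B) by rewrite mulr_gt0.
(* For this [n] the sum of the [c k * q] reaches the inverse of [delta * fine (P B)], so product
   times one plus sum would exceed [1]. *)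
have [n] := diverge ((delta * fine (P B))^-1 / q).
rewrite ler_pdivrMr// => large.
have x01 k : 0 <= c k * q <= 1.
  have /andP[? ?] := c01 k.
  by rewrite mulr_ge0 ?(ltW q0)//=; apply: mulr_ile1 => //; exact: ltW.
have := prod_le_inv_sum n x01; rewrite -mulr_suml; apply/negP; rewrite -ltNge.
apply: (@lt_le_trans _ _ (delta * fine (P B) * (1 + (delta * fine (P B))^-1))).
  by rewrite mulrDr mulr1 mulfV ?gt_eqF// ltrDr.
by apply: ler_pM; rewrite ?bound ?lerD2l// ?addr_ge0 ?invr_ge0// ltW.
Qed.

End DampedProducts.

(** * Almost sure properties of the initial profile *)

(** Each vertex ends a walk from a fixed one, and walks of a given length have countably many ends.
    Countability makes the level bounds hold almost surely at all vertices at once. *)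
Lemma connected_countable (V : choiceType) (e : rel V) :
  connected_graph e -> bounded_degree e -> countable [set: V].
Proof.
move=> conn [D deg].
have [[v _]|V0] := pselect ([set: V] !=set0); last first.
  by apply: finite_set_countable; rewrite (_ : [set: V] = set0)//;
     apply/seteqP; split => // x _; case: V0; exists x.
pose fix sphere n := if n is m.+1
  then \bigcup_(x in sphere m) [set y | e x y] else [set v].
have csphere n : countable (sphere n).
  elim: n => [|n IH] /=; first exact/finite_set_countable/finite_set1.
  apply: bigcup_countable => // x _; apply: finite_set_countable.
  exact: card_le_finite (deg x) (finite_II D).
rewrite (_ : [set: V] = \bigcup_n sphere n).
  by apply: bigcup_countable => // n _; exact: csphere.
apply/seteqP; split => // y _; have [p vp <-] := conn v y.
exists (size p) => //; elim/last_ind: p vp => [//|p z IH].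
rewrite rcons_path last_rcons size_rcons => /andP[vp pz].
by exists (last v p); [exact: IH|].
Qed.

(** A move replaces two levels by convex combinations of them, so an upper bound persists. *)
Lemma kappa_le (R : realType) (V : choiceType) (e : rel V) (eta : V -> R) M v :
  (forall x, eta x <= M) -> (kappa e eta v <= M%:E)%E.
Proof.
move=> etaM; apply: ge_ereal_sup => _ [ms adm <-]; rewrite lee_fin.
elim: ms eta etaM adm => [|[[x y] mu] ms IH] eta etaM //= /andP[].
move=> /andP[_ /andP[mu0 mu1]]; apply: IH => z /=.
have := etaM x; have := etaM y; case: ifP => _; last case: ifP => _ //; nra.
Qed.

Section Uniform.
Context (d : measure_display) (Omega : measurableType d) (R : realType).
Context (P : probability Omega R).

Lemma uniform01_ae (X : {RV P >-> R}) : uniform01 X ->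
  {ae P, forall w, 0 <= X w <= 1}.
Proof.
move=> unifX; exists (X @^-1` ~` `[0, 1]%classic); split.
- by apply: measurable_funPTI; exact: measurableC.
- rewrite -[LHS]/(distribution P X _) unifX; last exact: measurableC.
  by rewrite /uniform_prob integral_uniform_pdf setICl integral_set0.
- by move=> w /=; rewrite in_itv.
Qed.

Lemma uniform01_ge (X : {RV P >-> R}) (b : R) : uniform01 X -> 0 <= b < 1 ->
  P (X @^-1` `[b, +oo[) = (1 - b)%:E.
Proof.
move=> unifX /andP[b0 b1]; rewrite -[LHS]/(distribution P X _) unifX//.
rewrite /uniform_prob integral_uniform_pdf.
have -> : `[b, +oo[ `&` `[0, 1] = `[b, 1]%classic :> set R.
  apply/seteqP; split => x /=; rewrite !in_itv/= ?andbT.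
    by move=> [-> /andP[_ ->]].
  by move=> /andP[bx ->]; rewrite bx (le_trans b0 bx).
rewrite (eq_integral (fun=> 1%E)); last first.
  move=> x; rewrite inE/= in_itv/= /uniform_pdf => /andP[bx ->].
  by rewrite (le_trans b0 bx)/= subr0 invr1.
by rewrite integral_cst//= lebesgue_measure_itv/= lte_fin b1 mul1e.
Qed.

Lemma independent_high (I : choiceType) (X : I -> {RV P >-> R}) (u : nat -> I)
    (b : R) (s : seq nat) :
  (forall i, uniform01 (X i)) -> mutually_independent X -> injective u ->
  0 <= b < 1 -> uniq s ->
  P (\bigcap_(k in [set` s]) (X (u k) @^-1` `[b, +oo[)) = ((1 - b) ^+ size s)%:E.
Proof.
move=> unifX indX uinj b01 us.
have := indX (map u s) (fun=> `[b, +oo[%classic).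
rewrite map_inj_uniq// big_map => /(_ us (fun=> measurable_itv _)) indep.
transitivity (\prod_(k <- s) P (X (u k) @^-1` `[b, +oo[))%E.
  rewrite -indep; congr (P _); apply/seteqP; split => w Xw.
    by move=> _ /mapP[k ks ->]; exact: Xw.
  by move=> k ks; apply: Xw; exact: map_f.
elim: s {us indep} => [|k s IH]; first by rewrite big_nil.
by rewrite big_cons IH uniform01_ge// exprS EFinM.
Qed.

End Uniform.

(** * Divergence of the sum of shares *)

Lemma nneseries_unbounded (R : realType) (a : nat -> R) :
  (forall k, 0 <= a k) -> (\sum_(0 <= k <oo) (a k)%:E = +oo)%E ->
  forall M, exists n, M <= \sum_(k < n) a k.
Proof.
move=> a0 diverge M; apply: contrapT => /forallNP small.
have : (\sum_(0 <= k <oo) (a k)%:E <= M%:E)%E.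
  apply: lime_le; first by apply: is_cvg_nneseries => k _ _; rewrite lee_fin.
  apply: nearW => n; rewrite sumEFin lee_fin big_mkord.
  by apply/ltW; rewrite ltNge; apply/negP.
by rewrite diverge leye_eq.
Qed.

(** By injectivity at most [size s] indices are dropped, each costing at most [1]. *)
Lemma sum_skip_unbounded (R : realType) (V : choiceType) (u : nat -> V)
    (s : seq V) (a : nat -> R) :
  injective u -> (forall k, 0 <= a k <= 1) ->
  (forall M, exists n, M <= \sum_(k < n) a k) ->
  forall M, exists n, M <= \sum_(k < n) (if u k \notin s then a k else 0).
Proof.
move=> uinj a01 diverge M; have [n Mn] := diverge (M + (size s)%:R).
exists n; rewrite -(lerD2r (size s)%:R) (le_trans Mn)//.
rewrite (bigID (fun k : 'I_n => u k \notin s))/=.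
rewrite -[X in _ <= X + _]big_mkcond/= lerD2l.
apply: (@le_trans _ _ (\sum_(k < n | ~~ (u k \notin s)) 1)).
  by apply: ler_sum => k _; case/andP: (a01 k).
rewrite sumr_const ler_nat -(size_image (fun k : 'I_n => u k)).
apply: uniq_leq_size => [|_ /mapP[k + ->]]; last by rewrite mem_enum unfold_in negbK.
by rewrite map_inj_uniq ?enum_uniq// => i j /uinj/val_inj.
Qed.

(** * The almost sure value of [kappa] *)

Theorem theorem5p1 (R : realType) (V : choiceType) (e : rel V)
    (d : measure_display) (Omega : measurableType d) (P : probability Omega R)
    (eta0 : V -> {RV P >-> R}) (v : V)
    (Vinf : infinite_set [set: V])
    (esimple : simple_graph e)
    (econn : connected_graph e)
    (edeg : bounded_degree e)
    (eta0_unif : forall u : V, uniform01 (eta0 u))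
    (eta0_indep : mutually_independent eta0)
    (enr : neighbor_rich_half_line R e) :
  {ae P, forall w : Omega, kappa e (fun u => eta0 u w) v = 1%E}.
Proof.
have [esym eirr] := esimple.
have [h [u [f [[h_inj h_path] [[u_inj u_h] [f_inj [u_adj diverge]]]]]]] := enr.
have [p walk walk_end] := econn v (h 0).
have in01 : {ae P, forall w, forall x, 0 <= eta0 x w <= 1}.
  have /countable_injP[code code_inj] := connected_countable econn edeg.
  have : \forall w \ae P, forall n x, code x = n -> 0 <= eta0 x w <= 1.
    apply: ae_foralln => n.
    have [[x <-]|none] := pselect (exists x, code x = n).
      apply: filterS (uniform01_ae (eta0_unif x)) => w + y.
      by move=> + /code_inj => + -> //; rewrite inE.
    by apply: aeW => w x xn; case: none; exists x.
  by apply: filterS => w + x; exact.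
pose c k : R := if u k \notin v :: p then share R p f k else 0.
have c01 k : 0 <= c k <= 1.
  by rewrite /c; case: ifP; rewrite ?lexx ?ler01// share_ge0 share_le1.
have c_diverge : forall M, exists n, M <= \sum_(k < n) c k.
  apply: sum_skip_unbounded => // [k|M]; first by rewrite share_ge0 share_le1.
  (* Since [size p + f k + 1 <= (size p + 1) * (f k + 1)], each share is at least
     [1 / (K * (f k + 1))]. *)
  pose K : R := 4 * (size p).+1%:R.
  have K0 : 0 < K by rewrite mulr_gt0.
  have [|n] := @nneseries_unbounded R _ _ diverge (M * K).
    by move=> k; rewrite invr_ge0.
  rewrite -ler_pdivlMr// => Mn; exists n; rewrite (le_trans Mn)// mulr_suml.
  apply: ler_sum => k _; rewrite /share -invfM lef_pV2 ?posrE ?mulr_gt0//.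
  by rewrite /K mulrCA ler_pM2l// -natrM ler_nat -addnS addnC mulnS leq_add2l leq_pmull.
(* A countable family of tolerances: [t m] is both the gap between [b] and [1] and the threshold for
   the product. *)
pose t m : R := m.+2%:R^-1.
have t01 m : 0 < t m < 1 by rewrite invr_gt0 ltr0n invf_lt1// ltr1n.
pose G m k := eta0 (u k) @^-1` `[1 - t m, +oo[%classic.
have mG m k : measurable (G m k) by exact: measurable_funPTI.
have small : {ae P, forall w, forall m, exists n, damped_prod (G m) c n w < t m}.
  apply: ae_foralln => m; have /andP[t0 t1] := t01 m.
  exists (\bigcap_n [set w | t m <= damped_prod (G m) c n w]); split.
  - apply: bigcapT_measurable => n.
    rewrite -[X in measurable X]setTI.
    by apply: measurable_fun_ler => //; exact: measurable_damped_prod.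
  - apply: (@damped_prod_null _ _ _ P (G m) c (1 - (1 - t m))) => // [s us|].
      by apply: independent_high => //; lra.
    by lra.
  - by move=> w /= /forallNP big n _ /=; rewrite leNgt; apply/negP.
apply: filterS2 in01 small => w eta01 small.
have eta_ge0 x : 0 <= eta0 x w by case/andP: (eta01 x).
apply/le_anti/andP; split.
  by apply: kappa_le => x; case/andP: (eta01 x).
apply/lee_addgt0Pr => eps eps0.
have [m meps] : exists m, 2 * t m <= eps.
  exists (Num.bound (2 / eps)).
  rewrite ler_pdivrMr// mulrC -ler_pdivrMr// ltW//.
  apply: lt_le_trans (archi_boundP _) _; first by rewrite divr_ge0// ltW.
  by rewrite ler_nat ltnW.
have /andP[t0 t1] := t01 m; have [n small_n] := small m.
have b0 : 0 <= 1 - t m by lra.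
have := collected_level eirr walk walk_end h_path u_inj u_h u_adj n eta_ge0 b0.
rewrite (_ : \prod_(k < n) _ = damped_prod (G m) c n w); last first.
  apply: eq_bigr => k _; congr (_ - _); rewrite /c indicE.
  have -> : (w \in G m k) = (1 - t m <= eta0 (u k) w).
    by apply/idP/idP => [/set_mem|?]; [|apply/mem_set];
       rewrite /G /= in_itv/= andbT.
  by case: (_ \notin _); case: (_ <= _); rewrite ?mulr1 ?mulr0 ?mul0r.
have /andP[Y0 _] := damped_prod01 (G m) c01 n w.
move: small_n Y0; set Y := damped_prod _ _ _ _ => small_n Y0 low.
(* The attained level is at least [(1 - t m)^2], hence at least [1 - 2 * t m]. *)
rewrite -leeBlDr// (le_trans _ low)// -EFinB lee_fin; nra.
Qed.
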